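(* Let $P,Q\in\mathbb F[D,D^{-1}]\setminus\{0\}$ and let $L=\varphi^*P+Q\in\mathbb F[D,D^{-1},\varphi^*]$. Let $\overline L:=\gcd(P,\varphi^*(Q))$, $\widetilde P:=P/\overline L$ and $\widetilde Q:=\varphi^*(Q)/\overline L$, and define $\widetilde R:=\varphi^*\widetilde P-\widetilde Q\in\mathbb F[D,D^{-1},\varphi^*]$. Then $L\widetilde R\in\mathbb F[D,D^{-1}]$.
   Context: $\mathbb F$ is a field, $V$ a vector space over $\mathbb F$, and $\mathscr S$ is the $\mathbb F$-vector space of all functions $\mathbb Z\to V$ (two-sided sequences $x=(x_k)_{k\in\mathbb Z}$). The right shift operator $D:\mathscr S\to\mathscr S$ is $(Dx)_k=x_{k+1}$; it is bijective. The reflection pullback $\varphi^*:\mathscr S\to\mathscr S$ is $(\varphi^*x)_k=x_{-k}$. $\mathbb F[D,D^{-1}]$ denotes the commutative algebra of Laurent polynomials $\sum_{j\in\mathbb Z}a_jD^j$ with $a_j\in\mathbb F$, only finitely many nonzero, regarded as operators on $\mathscr S$. $\mathbb F[D,D^{-1},\varphi^*]$ denotes the algebra (under composition) of operators on $\mathscr S$ generated by $D^j$ and $\varphi^*D^j$, $j\in\mathbb Z$; products denote composition. For $P\in\mathbb F[D,D^{-1}]$, $\varphi^*(P)\in\mathbb F[D,D^{-1}]$ denotes the Laurent polynomial $\varphi^*(P)(D):=P(D^{-1})$ (to be distinguished from the composition $\varphi^*P$). Every nonzero $P\in\mathbb F[D,D^{-1}]$ can be written uniquely as $P=P_*(D)D^{k}$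 with $k\in\mathbb Z$ and $P_*\in\mathbb F[D]$ an ordinary polynomial not having $0$ as a root. For nonzero $P=P_*D^{k_1}$ and $Q=Q_*D^{k_2}$ of this form, $\gcd(P,Q):=\gcd(P_*,Q_* )\,D^{\nu(k_1,k_2)}$, where $\gcd(P_*,Q_* )$ is the usual monic greatest common divisor in $\mathbb F[D]$ and $\nu(k_1,k_2)=\min\{k_1,k_2\}$ if $k_1,k_2\geqslant 0$, $\nu(k_1,k_2)=\max\{k_1,k_2\}$ if $k_1,k_2\leqslant 0$, and $\nu(k_1,k_2)=0$ otherwise. By construction $\gcd(P,Q)$ divides $P$ and $Q$ in $\mathbb F[D,D^{-1}]$, and the quotients are taken in $\mathbb F[D,D^{-1}]$. *)

(* Defs.v *)
From HB Require Import structures.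
From mathcomp Require Import all_boot all_order all_algebra.
From mathcomp Require Import finmap boolp classical_sets functions.
From mathcomp.multinomials Require Import monalg.

Set Implicit Arguments.
Unset Strict Implicit.
Unset Printing Implicit Defensive.

Import Order.TTheory GRing.Theory Num.Theory.

Local Open Scope fset_scope.
Local Open Scope ring_scope.

(* The algebra F[D, D^-1].  The library only gives {malg F[K]} a product when
   K is a monomType, in which no element but 1 is invertible; this excludes
   K = int.  Hence the alias [laurent F], on which the convolution product is
   declared. *)
Definition laurent (F : fieldType) : Type := {malg F[int]}.

HB.instance Definition _ (F : fieldType) :=
  GRing.Lmodule.copy (laurent F) {malg F[int]}.

Section LaurentAlgebra.
Context {F : fieldType}.
Implicit Types (P Q R : laurent F) (k l : int) (c d : F).

(* D^k *)
Definition lmonom k : laurent F := << 1 *g k >>.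

Definition lmul P Q : laurent F :=
  \sum_(k <- msupp P) \sum_(l <- msupp Q) << P@_k * Q@_l *g k + l >>.

Lemma laurentE P :
  P = \sum_(k <- msupp P) (<< P@_k *g k >> : laurent F).
Proof. exact: monalgE. Qed.

Lemma lmulw (d1 d2 : {fset int}) P Q :
  msupp P `<=` d1 -> msupp Q `<=` d2 ->
  lmul P Q = \sum_(k <- d1) \sum_(l <- d2) << P@_k * Q@_l *g k + l >>.
Proof.
move=> le1 le2; rewrite /lmul (big_fset_incl _ le1) /=.
  apply/eq_bigr=> k _; apply/big_fset_incl => // l _ /mcoeff_outdom ->.
  by rewrite mulr0 monalgU0.
move=> k _ /mcoeff_outdom Pk.
by rewrite big1 => // l _; rewrite Pk mul0r monalgU0.
Qed.

Lemma lmulC : commutative lmul.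
Proof.
move=> P Q; rewrite /lmul exchange_big /=; apply/eq_bigr=> k _.
by apply/eq_bigr=> l _; rewrite mulrC addrC.
Qed.

Lemma lmulDl : left_distributive lmul +%R.
Proof.
move=> P Q R.
rewrite [X in _ = X + _](lmulw (fsubsetUl (msupp P) (msupp Q)) (fsubset_refl _)).
rewrite [X in _ = _ + X](lmulw (fsubsetUr (msupp P) (msupp Q)) (fsubset_refl _)).
have le_PQ : msupp (P + Q : laurent F) `<=` msupp P `|` msupp Q.
  exact: msuppD_le.
rewrite (lmulw le_PQ (fsubset_refl _)).
rewrite -big_split /=; apply/eq_bigr=> k _.
rewrite -big_split /=; apply/eq_bigr=> l _.
by rewrite mcoeffD mulrDl monalgUD.
Qed.

Lemma lmulDr : right_distributive lmul +%R.
Proof. by move=> P Q R; rewrite lmulC lmulDl !(lmulC P). Qed.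

Lemma lmul0 : left_zero 0 lmul.
Proof. by move=> P; rewrite /lmul msupp0 big_seq_fset0. Qed.

Lemma lmulr0 : right_zero 0 lmul.
Proof. by move=> P; rewrite lmulC lmul0. Qed.

Lemma lmulUU c d k l :
  lmul << c *g k >> << d *g l >> = << c * d *g k + l >>.
Proof. by rewrite (lmulw msuppU_le msuppU_le) !big_seq_fset1 !mcoeffUU. Qed.

Lemma lmulA : associative lmul.
Proof.
move=> P Q R.
have suml I r (f : I -> laurent F) X :
    lmul (\sum_(i <- r) f i) X = \sum_(i <- r) lmul (f i) X.
  exact: (big_morph (lmul^~ X) (fun _ _ => lmulDl _ _ _) (lmul0 _)).
have sumr I r (f : I -> laurent F) X :
    lmul X (\sum_(i <- r) f i) = \sum_(i <- r) lmul X (f i).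
  exact: (big_morph (lmul X) (fun _ _ => lmulDr _ _ _) (lmulr0 _)).
rewrite [in LHS](laurentE P) [in RHS](laurentE P) !suml; apply/eq_bigr=> k _.
rewrite [in LHS](laurentE Q) [in RHS](laurentE Q) suml !sumr suml; apply/eq_bigr=> l _.
rewrite [in LHS](laurentE R) [in RHS](laurentE R) !sumr; apply/eq_bigr=> m _.
by rewrite !lmulUU mulrA addrA.
Qed.

Lemma lmul1 : left_id (lmonom 0) lmul.
Proof.
move=> P; rewrite (lmulw msuppU_le (fsubset_refl _)) big_seq_fset1.
rewrite [RHS]laurentE; apply/eq_bigr=> l _.
by rewrite mcoeffUU mul1r add0r.
Qed.

Lemma lmonom0_neq0 : lmonom 0 != 0.
Proof. by rewrite /lmonom monalgU_eq0 oner_eq0. Qed.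

HB.instance Definition _ := GRing.Zmodule_isComNzRing.Build (laurent F)
  lmulA lmulC lmul1 lmulDl lmonom0_neq0.

Lemma lscaleAl c P Q : c *: (P * Q) = (c *: P) * Q.
Proof.
rewrite [in RHS]/GRing.mul /=.
rewrite (lmulw (msuppZ_le c P) (fsubset_refl _)) [in LHS]/GRing.mul /= /lmul.
rewrite scaler_sumr; apply/eq_bigr=> k _.
rewrite scaler_sumr; apply/eq_bigr=> l _.
by apply/malgP=> m; rewrite mcoeffZ !mcoeffU mcoeffZ -mulrA mulrnAr.
Qed.

HB.instance Definition _ := GRing.Lmodule_isLalgebra.Build F (laurent F)
  lscaleAl.

HB.instance Definition _ := GRing.Lalgebra_isComAlgebra.Build F (laurent F).

(* P(D^-1) *)
Definition lrefl P : laurent F := \sum_(k <- msupp P) P@_k *: lmonom (- k).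

(* For P != 0, the pair (p, k) with P = p(D) D^k and p(0) != 0; (0, 0) if
   P = 0, for which there is no such pair. *)
Definition lnormal P : {poly F} * int :=
  xget (0, 0) [set pk | P = horner_alg (lmonom 1) pk.1 * lmonom pk.2
                        /\ ~~ root pk.1 0]%classic.

(* [gcdp] is only a gcd up to a nonzero constant. *)
Definition monic_gcdp (p q : {poly F}) : {poly F} :=
  (lead_coef (gcdp p q))^-1 *: gcdp p q.

Definition lnu k l : int :=
  if (0 <= k) && (0 <= l) then Order.min k l
  else if (k <= 0) && (l <= 0) then Order.max k l
  else 0.

Definition lgcd P Q : laurent F :=
  let (p, k) := lnormal P in
  let (q, l) := lnormal Q in
  horner_alg (lmonom 1) (monic_gcdp p q) * lmonom (lnu k l).

(* The quotient P / Q in F[D, D^-1], unique when Q != 0; 0 if Q does not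
   divide P. *)
Definition ldiv P Q : laurent F := xget 0 [set X | P = X * Q]%classic.

End LaurentAlgebra.

Section Operators.
Context {F : fieldType} (V : lmodType F).

Definition signal : Type := int -> V.

HB.instance Definition _ := GRing.Lmodule.on signal.

(* D^j *)
Definition shift (j : int) : signal -> signal := fun x k => x (k + j).

Lemma shift0 : shift 0 = id.
Proof. by apply/funext => x; apply/funext => k; rewrite /shift addr0. Qed.

Lemma shiftD i j : shift (i + j) = shift i \o shift j.
Proof. by apply/funext => x; apply/funext => k; rewrite /shift /= addrA. Qed.

Definition refl_op : signal -> signal := fun x k => x (- k).

(* The sum and scaling are the pointwise ones on signal -> signal. *)
Definition laurent_op (P : laurent F) : signal -> signal :=
  \sum_(j <- msupp P) P@_j *: shift j.

Definition laurent_ops : set (signal -> signal) := range laurent_op.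

Definition subalgebra (A : set (signal -> signal)) : Prop :=
  [/\ A id,
      forall S T, A S -> A T -> A (S + T),
      forall (c : F) S, A S -> A (c *: S)
    & forall S T, A S -> A T -> A (S \o T)].

(* F[D, D^-1, phi^*] *)
Definition mixed_ops : set (signal -> signal) :=
  smallest subalgebra
    [set T | exists j, T = shift j \/ T = refl_op \o shift j]%classic.

Lemma subalgebra_mixed_ops : subalgebra mixed_ops.
Proof.
split=> [A [[A1 _ _ _] _] //|S T AS AT A cA|c S AS A cA|S T AS AT A cA].
- by have [[_ AD _ _] _] := cA; apply: AD; [exact: AS|exact: AT].
- by have [[_ _ AZ _] _] := cA; apply: AZ; exact: AS.
- by have [[_ _ _ AM] _] := cA; apply: AM; [exact: AS|exact: AT].
Qed.

Lemma mixed_ops_laurent (P : laurent F) : mixed_ops (laurent_op P).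
Proof.
have [M1 MD MZ _] := subalgebra_mixed_ops.
rewrite /laurent_op; elim/big_ind: _ => // [|j _].
  by rewrite -(scale0r (id : signal -> signal)); exact: MZ.
by apply: MZ => A [_]; apply; exists j; left.
Qed.

Lemma mixed_ops_refl : mixed_ops refl_op.
Proof. by move=> A [_]; apply; exists 0; right; rewrite shift0. Qed.

Lemma mixed_opsD (P Q : laurent F) :
  mixed_ops ((refl_op \o laurent_op P) + laurent_op Q).
Proof.
have [_ MD _ MM] := subalgebra_mixed_ops.
apply: MD (mixed_ops_laurent Q).
exact: MM mixed_ops_refl (mixed_ops_laurent P).
Qed.

Lemma mixed_opsB (P Q : laurent F) :
  mixed_ops ((refl_op \o laurent_op P) - laurent_op Q).
Proof.
have [_ MD MZ MM] := subalgebra_mixed_ops.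
rewrite -scaleN1r; apply: MD (MZ _ _ (mixed_ops_laurent Q)).
exact: MM mixed_ops_refl (mixed_ops_laurent P).
Qed.

End Operators.

Arguments shift {F} V j _ _.
Arguments refl_op {F} V _ _.
Arguments laurent_op {F} V P _ _.
Arguments laurent_ops {F} V _.
Arguments mixed_ops {F} V _.

(* Main.v *)
Require Import Defs.
From mathcomp Require Import all_boot all_order all_algebra.
From mathcomp Require Import boolp classical_sets functions.
From mathcomp Require Import finmap.
From mathcomp.multinomials Require Import monalg.

Set Implicit Arguments.
Unset Strict Implicit.
Unset Printing Implicit Defensive.

Import Order.TTheory GRing.Theory Num.Theory.
Local Open Scope fset_scope.
Local Open Scope ring_scope.

(** Write [s P] for [lrefl P], that is P(D^-1), and phi for the reflection.
    Everything comes from the commutation rule P phi = phi s(P)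
    ([laurent_op_refl]): reflecting a sequence turns D into D^-1.  Together
    with phi phi = id it moves every reflection in a product to the left
    ([mixed_op_comp]):
      (phi A + B) (phi C + E) = (s(A) C + B E) + phi (A E + s(B) C).
    So a product of two mixed operators is a Laurent operator as soon as its
    reflected part A E + s(B) C vanishes.  For the operators at hand this part
    is s(Q) Pt - P Qt, where P = Pt G, s(Q) = Qt G and G = gcd(P, s(Q)); it is
    Qt G Pt - Pt G Qt = 0 by commutativity.

    It remains to see that G divides P and s(Q).  The powers of D are units, so
    divisibility can be read off the polynomial factors p and q of the normal
    forms P = p(D) D^k and s(Q) = q(D) D^l, where it is the divisibility of p
    and q by their gcd ([lgcd_dvdl], [lgcd_dvdr]).  The point to check is that
    normal forms exist ([lnormalP]), for otherwise the gcd would be computed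
    from a default value. *)

(** * Divisibility of Laurent polynomials by their gcd *)

Section LaurentDivisibility.
Context {F : fieldType}.
Implicit Types (P Q : laurent F) (p q : {poly F}) (k l : int) (c : F).

Local Notation atD := (horner_alg (lmonom 1 : laurent F)).

Lemma lmonomD k l : lmonom (k + l) = lmonom k * lmonom l :> laurent F.
Proof. by rewrite [RHS]lmulUU mulr1. Qed.

Lemma lmonomX k (n : nat) :
  lmonom k ^+ n = lmonom (k *+ n) :> laurent F.
Proof.
elim: n => [|n IHn]; first by rewrite expr0 mulr0n.
by rewrite exprS IHn -lmonomD mulrS.
Qed.

Lemma scale_lmonom c k : c *: lmonom k = << c *g k >> :> laurent F.
Proof. by apply/malgP => l; rewrite mcoeffZ !mcoeffU mulrnAr mulr1. Qed.

Lemma horner_alg_Xn (n : nat) : atD ('X^n) = lmonom n%:Z.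
Proof. by rewrite rmorphXn /= horner_algX lmonomX pmulrn intz. Qed.

Lemma lpoly_form_widen p k l :
  l <= k -> atD p * lmonom k = atD (p * 'X^(`|k - l|%N)) * lmonom l.
Proof.
move=> le_lk; rewrite rmorphM /= horner_alg_Xn -mulrA -lmonomD.
by rewrite gez0_abs ?subrK // subr_ge0.
Qed.

Lemma lpoly_form_exists P : exists p k, P = atD p * lmonom k.
Proof.
rewrite [P]laurentE; elim/big_ind: _ => [|_ _ [p [k ->]] [q [l ->]]|k _].
- by exists 0, 0; rewrite rmorph0 mul0r.
- (* Both summands are rewritten over the lower of the two powers of D. *)
  exists (p * 'X^(`|k - Order.min k l|%N) + q * 'X^(`|l - Order.min k l|%N)).
  exists (Order.min k l).
  by rewrite rmorphD /= mulrDl -!lpoly_form_widen // ge_min lexx ?orbT.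
- by exists (P@_k)%:P, k; rewrite horner_algC -scalerAl mul1r scale_lmonom.
Qed.

(** Start from any expression p(D) D^k: the multiplicity of the root 0 of p
    tells how many factors D must pass from p(D) to D^k. *)
Lemma lnormal_exists P : P != 0 ->
  exists p k, P = atD p * lmonom k /\ ~~ root p 0.
Proof.
have [p [k ->]] := lpoly_form_exists P => nz.
have p_neq0 : p != 0 by apply: contraNneq nz => ->; rewrite rmorph0 mul0r.
have [m [q]] := multiplicity_XsubC p 0; rewrite p_neq0 /= subr0 => q0 ->.
exists q, (m%:Z + k); split=> //.
by rewrite rmorphM /= horner_alg_Xn lmonomD mulrA.
Qed.

(** Zero has no normal form, but the default pair (0, 0) still represents it, so
    the factorization holds without exception. *)
Lemma lnormalP P : P = atD (lnormal P).1 * lmonom (lnormal P).2.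
Proof.
rewrite /lnormal; case: xgetP => [pk _ []//|no_form /=].
have [->|/lnormal_exists [p [k nfP]]] := eqVneq P 0; last by case: (no_form (p, k)).
by rewrite rmorph0 mul0r.
Qed.

Lemma monic_gcdp_dvdl p q : monic_gcdp p q %| p.
Proof.
rewrite /monic_gcdp; have [g0|g_neq0] := eqVneq (gcdp p q) 0.
  by move/eqP: g0; rewrite gcdp_eq0 => /andP[/eqP-> _]; exact: dvdp0.
by rewrite dvdpZl ?invr_eq0 ?lead_coef_eq0 // dvdp_gcdl.
Qed.

Lemma monic_gcdp_dvdr p q : monic_gcdp p q %| q.
Proof.
rewrite /monic_gcdp; have [g0|g_neq0] := eqVneq (gcdp p q) 0.
  by move/eqP: g0; rewrite gcdp_eq0 => /andP[_ /eqP->]; exact: dvdp0.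
by rewrite dvdpZl ?invr_eq0 ?lead_coef_eq0 // dvdp_gcdr.
Qed.

(** Since D is a unit, D^k is a multiple of D^l for all k and l, so that only
    the polynomial factors have to be divided. *)
Lemma lpoly_form_dvd p q k l :
  q %| p -> exists X, atD p * lmonom k = X * (atD q * lmonom l).
Proof.
move=> /divpK <-; exists (atD (p %/ q) * lmonom (k - l)).
by rewrite rmorphM /= mulrACA -lmonomD subrK.
Qed.

Lemma lgcd_dvdl P Q : exists X, P = X * lgcd P Q.
Proof.
have := lnormalP P; rewrite /lgcd; case: (lnormal P) (lnormal Q) => p k [q l] /=.
by move=> {1}->; apply: lpoly_form_dvd; exact: monic_gcdp_dvdl.
Qed.

Lemma lgcd_dvdr P Q : exists X, Q = X * lgcd P Q.
Proof.
have := lnormalP Q; rewrite /lgcd; case: (lnormal P) (lnormal Q) => p k [q l] /=.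
by move=> {1}->; apply: lpoly_form_dvd; exact: monic_gcdp_dvdr.
Qed.

Lemma ldivK P Q : (exists X, P = X * Q) -> ldiv P Q * Q = P.
Proof. by move=> dvdQP; apply/esym; exact: (xgetPex 0 dvdQP). Qed.

End LaurentDivisibility.

(** * Laurent polynomials and the reflection as operators *)

Section LaurentOperators.
Context {F : fieldType} (V : lmodType F).
Implicit Types (P Q A B C E : laurent F) (x y : signal V) (i j k : int).

Lemma laurent_opE P x i : laurent_op V P x i = \sum_(j <- msupp P) P@_j *: x (i + j).
Proof. by rewrite /laurent_op; elim/big_rec2: _ => // j _ f _ <-. Qed.

Lemma laurent_opEw (d : {fset int}) P x i : msupp P `<=` d ->
  laurent_op V P x i = \sum_(j <- d) P@_j *: x (i + j).
Proof.
move=> led; rewrite laurent_opE; apply: big_fset_incl => // j _ /mcoeff_outdom ->.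
by rewrite scale0r.
Qed.

Lemma laurent_opD P Q : laurent_op V (P + Q) = laurent_op V P + laurent_op V Q.
Proof.
apply/funext => x; apply/funext => i.
rewrite (@laurent_opEw (msupp P `|` msupp Q) (P + Q)) ?msuppD_le //.
rewrite -[RHS]/(laurent_op V P x i + laurent_op V Q x i).
rewrite (laurent_opEw _ _ (fsubsetUl (msupp P) (msupp Q))).
rewrite (laurent_opEw _ _ (fsubsetUr (msupp P) (msupp Q))) -big_split /=.
by apply: eq_bigr => j _; rewrite mcoeffD scalerDl.
Qed.

Lemma laurent_op0 : laurent_op V 0 = 0.
Proof. by rewrite /laurent_op msupp0 big_seq_fset0. Qed.

Lemma laurent_opU (c : F) k x i :
  laurent_op V << c *g k >> x i = c *: x (i + k).
Proof. by rewrite (laurent_opEw _ _ msuppU_le) big_seq_fset1 mcoeffUU. Qed.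

Lemma laurent_op_sum (I : Type) (r : seq I) (f : I -> laurent F) x i :
  laurent_op V (\sum_(a <- r) f a) x i = \sum_(a <- r) laurent_op V (f a) x i.
Proof.
by apply: (big_morph (fun P => laurent_op V P x i)) => [P Q|];
  rewrite ?laurent_opD ?laurent_op0.
Qed.

Lemma laurent_opM P Q x :
  laurent_op V (P * Q) x = laurent_op V P (laurent_op V Q x).
Proof.
apply/funext => i; rewrite -[P * Q]/(lmul P Q) /lmul laurent_op_sum laurent_opE.
apply: eq_bigr => k _; rewrite laurent_op_sum laurent_opE scaler_sumr.
by apply: eq_bigr => l _; rewrite laurent_opU scalerA addrA.
Qed.

Lemma laurent_op_additive P x y :
  laurent_op V P (x + y) = laurent_op V P x + laurent_op V P y.
Proof.
apply/funext => i; rewrite -[RHS]/(laurent_op V P x i + laurent_op V P y i).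
by rewrite !laurent_opE -big_split; apply: eq_bigr => j _; exact: scalerDr.
Qed.

Lemma laurent_opN P : laurent_op V (- P) = - laurent_op V P.
Proof. by apply/eqP; rewrite -addr_eq0 -laurent_opD addNr laurent_op0. Qed.

(** Reading a reflected sequence j steps ahead is reading the original one
    j steps back, so D^j phi = phi D^-j. *)
Lemma laurent_op_refl P x :
  laurent_op V P (refl_op V x) = refl_op V (laurent_op V (lrefl P) x).
Proof.
apply/funext => i; rewrite -[RHS]/(laurent_op V (lrefl P) x (- i)) /lrefl.
rewrite laurent_op_sum laurent_opE; apply: eq_bigr => j _.
by rewrite scale_lmonom laurent_opU /refl_op opprD.
Qed.

Lemma refl_opK : involutive (refl_op V).
Proof. by move=> x; apply/funext => i; rewrite /refl_op opprK. Qed.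

Definition mixed_op A B : signal V -> signal V :=
  (refl_op V \o laurent_op V A) + laurent_op V B.

(** Reflections are moved to the left by [laurent_op_refl]; in the terms
    with two of them they cancel. *)
Lemma mixed_op_comp A B C E :
  mixed_op A B \o mixed_op C E =
  mixed_op (A * E + lrefl B * C) (lrefl A * C + B * E).
Proof.
have reflD x y : refl_op V (x + y) = refl_op V x + refl_op V y by [].
have opD P Q x : laurent_op V (P + Q) x = laurent_op V P x + laurent_op V Q x.
  by rewrite laurent_opD.
apply/funext => x.
rewrite -[LHS]/(refl_op V (laurent_op V A (refl_op V (laurent_op V C x)
                                          + laurent_op V E x))
  + laurent_op V B (refl_op V (laurent_op V C x) + laurent_op V E x)).
rewrite -[RHS]/(refl_op V (laurent_op V (A * E + lrefl B * C) x)
  + laurent_op V (lrefl A * C + B * E) x).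
rewrite !laurent_op_additive !laurent_op_refl reflD refl_opK !opD reflD !laurent_opM.
by rewrite [X in X + _ = _]addrC addrACA.
Qed.

End LaurentOperators.

Theorem theorem2p6 (F : fieldType) (V : lmodType F) (P Q : laurent F)
    (P_neq0 : P != 0) (Q_neq0 : Q != 0) :
  let L : signal V -> signal V :=
    (refl_op V \o laurent_op V P) + laurent_op V Q in
  let Lbar := lgcd P (lrefl Q) in
  let Pt := ldiv P Lbar in
  let Qt := ldiv (lrefl Q) Lbar in
  let Rt : signal V -> signal V :=
    (refl_op V \o laurent_op V Pt) - laurent_op V Qt in
  laurent_ops V (L \o Rt).
Proof.
move=> L Lbar Pt Qt Rt.
have defP : Pt * Lbar = P by apply: ldivK; exact: lgcd_dvdl.
have defQ : Qt * Lbar = lrefl Q by apply: ldivK; exact: lgcd_dvdr.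
exists (lrefl P * Pt + Q * - Qt) => //.
have -> : L \o Rt = mixed_op P Q \o mixed_op Pt (- Qt).
  by rewrite /mixed_op laurent_opN.
rewrite mixed_op_comp.
have -> : P * - Qt + lrefl Q * Pt = 0.
  rewrite -defQ -[X in X * - Qt]defP mulrN ![_ * Lbar * _]mulrAC (mulrC Qt).
  exact: addNr.
by rewrite /mixed_op laurent_op0; apply/funext => x; apply/esym; exact: add0r.
Qed.
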